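(* Consider the ICF-NCG with cost parameter $\alpha\ge1$. Then, for every $n\ge2$, there exist pairwise stable networks $G$ and $G'$ on $n$ nodes such that $GS(G)=LS(G)=1$ and $GS(G')=LS(G')=\frac1{n-1}$.
   Context: A network is an undirected graph $G=(V,E)$ whose nodes are agents; the set $V$ of agents is partitioned into $k\ge2$ disjoint types. For $u\in V$: $\deg_G(u)$ is its degree, $f_G(u)$ is the number of neighbors of $u$ having the same type as $u$, $d_G(u,v)$ is the length of a shortest path from $u$ to $v$ in $G$, and $d_G(u)=\sum_{v\in V}d_G(u,v)$. In the ICF-NCG (network creation game with increasing comfort among friends) with parameter $\alpha>0$, the cost of agent $u$ in $G$ is $$c_G(u)=\deg_G(u)\cdot\alpha\left(1+\frac{1}{f_G(u)+1}\right)+d_G(u).$$ A network $G=(V,E)$ is pairwise stable if (i) for every agent $u$ and every neighbor $v$ of $u$, $c_G(u)\le c_{G-uv}(u)$; and (ii) for every agent $u$ and every non-neighbor $v\ne u$ of $u$, $c_G(u)\le c_{G+uv}(u)$ or $c_G(v)\le c_{G+uv}(v)$. Here $G-uv$ and $G+uv$ denote $G$ with the edge $uv$ deleted or added, respectively. The local segregation of $G$ is $LS(G)=\frac1{|V|}\sum_{u\in V}\frac{f_G(u)}{\deg_G(u)}$ and the global segregation is $GS(G)=\frac{\sum_{u\in V}f_G(u)}{2|E|}$. *)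

(* Defs.v *)
From mathcomp Require Import all_boot all_order all_algebra.
From mathcomp Require Import boolp classical_sets reals constructive_ereal ereal.

Set Implicit Arguments.
Unset Strict Implicit.
Unset Printing Implicit Defensive.

Import Order.TTheory GRing.Theory Num.Theory.

Local Open Scope ring_scope.

(* A simple graph on V is given by its set of edges, each edge being a
   two-element set of nodes.  The partition of the agents into types is given
   by its class function V -> T; it need not be surjective, that is, a type may
   have no agent. *)
Record network (V T : finType) := Network {
  edges : {set {set V}};
  agent_type : V -> T;
  edges_card2 : forall e, e \in edges -> #|e| = 2%N
}.

Section Graph.
Variables (V T : finType).
Implicit Types (E : {set {set V}}) (tau : V -> T) (u v : V).

Definition adj E u v : bool := [set u; v]%SET \in E.

Definition deg E u : nat := #|[pred v | adj E u v]|.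

Definition friends E tau u : nat :=
  #|[pred v | adj E u v & tau v == tau u]|.

Definition del_edge E u v : {set {set V}} := (E :\ [set u; v])%SET.

Definition add_edge E u v : {set {set V}} := ([set u; v] |: E)%SET.

End Graph.

Section Cost.
Variables (R : realType) (V T : finType).
Implicit Types (E : {set {set V}}) (tau : V -> T) (u v : V).

(* Length of a shortest path from u to v; the infimum of the empty set is +oo,
   so that nodes in different components are at infinite distance. *)
Definition dist E u v : \bar R :=
  ereal_inf [set ((size p)%:R)%:E | p in
    [set p : seq V | [/\ path (adj E) u p, uniq (u :: p) & last u p = v]]]%classic.

Definition total_dist E u : \bar R := (\sum_(v : V) dist E u v)%E.

Definition cost (alpha : R) E tau u : \bar R :=
  (((deg E u)%:R * (alpha * (1 + 1 / ((friends E tau u)%:R + 1))))%:E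
   + total_dist E u)%E.

Definition pairwise_stable (alpha : R) (G : network V T) : Prop :=
  let E := edges G in
  let c E' := cost alpha E' (agent_type G) in
  (forall u v, adj E u v -> (c E u <= c (del_edge E u v) u)%E) /\
  (forall u v, v != u -> ~~ adj E u v ->
     (c E u <= c (add_edge E u v) u)%E \/ (c E v <= c (add_edge E u v) v)%E).

(* Since x / 0 = 0 here, the two quotients below have their usual meaning only
   when every degree is positive; see [no_isolated]. *)
Definition local_segregation (G : network V T) : R :=
  1 / #|V|%:R * \sum_(u : V)
    (friends (edges G) (agent_type G) u)%:R / (deg (edges G) u)%:R.

Definition global_segregation (G : network V T) : R :=
  (\sum_(u : V) (friends (edges G) (agent_type G) u)%:R)
  / (2 * #|edges G|%:R).

End Cost.

Definition no_isolated (V T : finType) (G : network V T) : Prop :=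
  forall u : V, (0 < deg (edges G) u)%N.

(* Main.v *)
(** Both networks are stars.  A star is pairwise stable for every assignment of
    types: deleting an edge disconnects it, and a new edge between two leaves
    shortens only one distance, by 1, while it raises the edge cost of each of
    them by at least [alpha].  The local and the global segregation of a star
    both equal [F / (n - 1)], where [F] is the number of leaves having the type
    of the center, so it remains to choose the types with [F = n - 1] and with
    [F = 1]. *)
Require Import Defs.
From mathcomp Require Import all_boot all_order all_algebra.
From mathcomp Require Import reals constructive_ereal ereal.
From mathcomp Require Import ring lra.

Set Implicit Arguments.
Unset Strict Implicit.
Unset Printing Implicit Defensive.

Import Order.TTheory GRing.Theory Num.Theory.

Local Open Scope ring_scope.

Lemma eq_set2 (V : finType) (a b x y : V) :
  ([set a; b] == [set x; y] :> {set V})%SET =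
  (a == x) && (b == y) || (a == y) && (b == x).
Proof.
apply/eqP/orP => [e|[/andP[/eqP-> /eqP->]|/andP[/eqP-> /eqP->]]]; last 2 first.
- by [].
- exact: setUC.
have := set21 a b; have := set22 a b; rewrite e !inE.
have := set21 x y; have := set22 x y; rewrite -e !inE.
rewrite (eq_sym x a) (eq_sym x b) (eq_sym y a) (eq_sym y b).
by case: (a == x) (a == y) (b == x) (b == y) => [] [] [] []; auto.
Qed.

(** * Distances in an arbitrary graph *)

Section Distance.
Variables (R : realType) (V : finType).
Implicit Types (E : {set {set V}}) (u v w : V) (p : seq V).

Lemma adj_add_edge E a b u v :
  adj (add_edge E a b) u v =
  [|| (u == a) && (v == b), (u == b) && (v == a) | adj E u v].
Proof. by rewrite /adj !inE eq_set2 orbA. Qed.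

Lemma adj_del_edge E a b u v :
  adj (del_edge E a b) u v =
  ~~ ((u == a) && (v == b) || (u == b) && (v == a)) && adj E u v.
Proof. by rewrite /adj !inE eq_set2. Qed.

Lemma dist_le_size E u p : path (adj E) u p -> uniq (u :: p) ->
  (dist R E u (last u p) <= (size p)%:R%:E)%E.
Proof. by move=> Ep Up; apply: ereal_inf_lbound; exists p. Qed.

(** The infimum in [dist] runs over simple paths, so a bound valid for all walks suffices. *)
Lemma le_dist E u v (x : \bar R) :
  (forall p, path (adj E) u p -> last u p = v -> x <= (size p)%:R%:E)%E ->
  (x <= dist R E u v)%E.
Proof.
by move=> lb; apply: le_ereal_inf_tmp => _ [p [Ep _ pv] <-]; apply: lb.
Qed.

Lemma dist_ge0 E u v : (0 <= dist R E u v)%E.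
Proof. by apply: le_dist => p _ _; rewrite lee_fin. Qed.

Lemma dist_ge1 E u v : u != v -> (1 <= dist R E u v)%E.
Proof.
move=> uv; apply: le_dist => -[|w p] _ /=; first by move/eqP: uv.
by rewrite lee_fin ler1n.
Qed.

Lemma dist_ge2 E u v : u != v -> ~~ adj E u v -> (2%:E <= dist R E u v)%E.
Proof.
move=> uv nuv; apply: le_dist => -[|w [|w' p]] /=.
- by move/eqP: uv.
- by rewrite andbT => uw wv; rewrite -wv uw in nuv.
- by rewrite lee_fin ler_nat.
Qed.

(** A walk to another node would need a first edge at [u]; the infimum is over the empty set. *)
Lemma dist_isolated_source E u v :
  u != v -> (forall w, ~~ adj E u w) -> dist R E u v = +oo%E.
Proof.
move=> uv iso; apply/eqP; rewrite -leye_eq; apply: le_dist => -[|w p] /=.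
  by move/eqP: uv.
by rewrite (negbTE (iso w)).
Qed.

Lemma dist_isolated_target E u v :
  u != v -> (forall w, ~~ adj E w v) -> dist R E u v = +oo%E.
Proof.
move=> uv iso; apply/eqP; rewrite -leye_eq; apply: le_dist => p.
case/lastP: p => [|p w] /=; first by move/eqP: uv.
by rewrite rcons_path last_rcons => /andP[_ pw] wv; rewrite wv (negbTE (iso _)) in pw.
Qed.

Lemma total_dist_pinfty E u v :
  dist R E u v = +oo%E -> total_dist R E u = +oo%E.
Proof.
(* The term [+oo] absorbs the other summands only if their sum is not [-oo]; this holds because
   distances are nonnegative. *)
move=> uv; rewrite /total_dist (bigD1 v) //= uv addye // -ltNye.
by apply: (@lt_le_trans _ _ 0%E); rewrite ?ltNy0 // sume_ge0 // => w _; apply: dist_ge0.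
Qed.

End Distance.

(** * Degrees and friends in the star with center [c] *)

Section Star.
Variables (V : finType) (c : V).
Implicit Types u v w : V.

Definition star : {set {set V}} := [set [set c; v] | v in [set~ c]]%SET.

Lemma adj_star u v : adj star u v = (u != v) && ((u == c) || (v == c)).
Proof.
apply/imsetP/andP => [[w]|[uv]].
  rewrite !inE => wc /eqP; rewrite eq_set2.
  by case/orP=> /andP[/eqP-> /eqP->]; rewrite eqxx ?orbT // eq_sym.
case/orP=> /eqP e; subst; [exists v|exists u]; rewrite // ?inE 1?eq_sym //.
  by rewrite eq_sym.
by rewrite setUC.
Qed.

Lemma card_star_edge e : e \in star -> #|e| = 2%N.
Proof. by case/imsetP=> v; rewrite !inE => vc ->; rewrite cards2 eq_sym vc. Qed.

Lemma card_star : #|star| = #|V|.-1.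
Proof.
rewrite card_in_imset ?cardsC1 // => x y; rewrite !inE => xc yc /eqP.
by rewrite eq_set2 eqxx /= => /orP[/eqP//|/andP[/eqP e]]; rewrite e eqxx in yc.
Qed.

Lemma deg_star_center : deg star c = #|V|.-1.
Proof.
by rewrite /deg -(cardC1 c); apply: eq_card => v; rewrite !inE adj_star eqxx andbT eq_sym.
Qed.

Lemma deg_star_leaf u : u != c -> deg star u = 1%N.
Proof.
move=> uc; rewrite /deg -(card1 c); apply: eq_card => v; rewrite !inE adj_star (negbTE uc) /=.
by case: (eqVneq v c) => [->|]; rewrite ?uc ?andbT ?andbF.
Qed.

Variables (T : finType) (tau : V -> T).

Definition same_type_leaves : nat := #|[pred v | v != c & tau v == tau c]|.

Lemma friends_star_center : friends star tau c = same_type_leaves.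
Proof.
by apply: eq_card => v; rewrite !inE adj_star eqxx andbT eq_sym.
Qed.

Lemma friends_star_leaf u : u != c -> friends star tau u = (tau u == tau c).
Proof.
move=> uc; case: (boolP (tau u == tau c)) => tuc.
  rewrite /friends /= -(card1 c); apply: eq_card => v; rewrite !inE adj_star (negbTE uc) /=.
  by case: (eqVneq v c) => [->|]; rewrite ?andbF // uc (eq_sym (tau c)) tuc.
rewrite /friends; apply: eq_card0 => v; rewrite !inE adj_star (negbTE uc) /=.
by case: (eqVneq v c) => [->|]; rewrite ?andbF // (eq_sym (tau c)) (negbTE tuc) andbF.
Qed.

(** The only neighbor of a leaf is the center, so a leaf contributes 1 if it has the type of [c] and
    0 otherwise. *)
Lemma sum_friends_star_leaves :
  (\sum_(u | u != c) friends star tau u)%N = same_type_leaves.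
Proof.
rewrite (eq_bigr (fun u => (tau u == tau c) : nat)); last first.
  by move=> u; apply: friends_star_leaf.
by rewrite -big_mkcondr /= sum1_card.
Qed.

Definition star_network : network V T := Network tau card_star_edge.

Lemma no_isolated_star : (1 < #|V|)%N -> no_isolated star_network.
Proof.
move=> V1 u; case: (eqVneq u c) => [->|uc] /=; last by rewrite deg_star_leaf.
by rewrite deg_star_center; case: #|V| V1 => [|[]].
Qed.

(** * Pairwise stability of the star *)

Section Stability.
Variables (R : realType) (alpha : R).

Lemma dist_star_center_leaf u : u != c -> (dist R star u c <= 1)%E.
Proof.
move=> uc; apply: (@dist_le_size _ _ star u [:: c]) => /=.
  by rewrite adj_star uc eqxx orbT.
by rewrite inE uc.
Qed.

(** The route through [c] is a simple path only if [u], [c], [v] are distinct, hence the separate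
    cases. *)
Lemma dist_star_le2 u v : u != c -> (dist R star u v <= 2%:E)%E.
Proof.
move=> uc; case: (eqVneq v c) => [->|vc].
  by apply: le_trans (dist_star_center_leaf uc) _; rewrite lee_fin ler1n.
case: (eqVneq u v) => [<-|uv].
  by apply: le_trans (@dist_le_size _ _ star u [::] _ _) _; rewrite // lee_fin ler_nat.
apply: (@dist_le_size _ _ star u [:: c; v]) => /=.
  by rewrite !adj_star uc eqxx orbT eq_sym vc.
by rewrite !inE negb_or uc uv eq_sym vc.
Qed.

(** Only the distance to [v] can drop, from 2 to 1, and the indicator pays for it. Any other leaf
    [w] remains non-adjacent to [u], hence at distance at least 2. *)
Lemma dist_star_add_edge u v w : u != c -> v != c -> u != v ->
  (dist R star u w <=
   dist R (add_edge star u v) u w + (w == v)%:R%:E)%E.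
Proof.
move=> uc vc uv; case: (eqVneq w v) => [->|wv].
  apply: le_trans (dist_star_le2 v uc) _.
  have -> : (2%:E = 1 + 1 :> \bar R)%E by rewrite -EFinD.
  by rewrite leeD2r // dist_ge1.
rewrite adde0; case: (eqVneq u w) => [<-|uw].
  by apply: le_trans (@dist_le_size _ _ star u [::] _ _) (dist_ge0 _ _ _ _).
case: (eqVneq w c) => [->|wc].
  exact: le_trans (dist_star_center_leaf uc) (dist_ge1 _ _ uc).
apply: le_trans (dist_star_le2 w uc) (dist_ge2 _ uw _).
by rewrite adj_add_edge adj_star (negbTE wv) (negbTE uc) (negbTE wc) (negbTE uv) !andbF.
Qed.

Lemma total_dist_star_add_edge u v : u != c -> v != c -> u != v ->
  (total_dist R star u <= total_dist R (add_edge star u v) u + 1)%E.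
Proof.
move=> uc vc uv.
(* As a sum of indicators, 1 can be distributed over the nodes and the bound checked termwise. *)
have -> : (1 = \sum_w (w == v)%:R%:E :> \bar R)%E.
  by rewrite (bigD1 v) //= eqxx big1 ?adde0 // => w /negbTE->.
by rewrite -big_split; apply: lee_sum => w _; apply: dist_star_add_edge.
Qed.

Lemma deg_star_add_edge u v : u != c -> v != c -> u != v ->
  deg (add_edge star u v) u = 2%N.
Proof.
move=> uc vc uv; rewrite /deg -[RHS](_ : #|pred2 c v| = _); last first.
  by rewrite card2 eq_sym vc.
apply: eq_card => w; rewrite !inE adj_add_edge adj_star eqxx (negbTE uc) (negbTE uv) /= orbC.
by case: (eqVneq w c) => [->|]; rewrite ?andbF ?uc.
Qed.

Lemma friends_star_add_edge u v : u != c -> v != c -> u != v ->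
  (friends (add_edge star u v) tau u <= (friends star tau u).+1)%N.
Proof.
move=> uc vc uv.
apply: (@leq_trans #|[predU1 v & [pred w | adj star u w & tau w == tau u]]|).
  apply: subset_leq_card; apply/subsetP => w; rewrite !inE adj_add_edge eqxx (negbTE uv) /=.
  by case: eqVneq.
by rewrite cardU1 -add1n leq_add2r leq_b1.
Qed.

(** A leaf goes from one edge and [f] friends to two edges and [f'] friends; the added 1 on the left
    is its largest possible gain in distance. Of the five cases the tightest is [f = 0], [f' = 1],
    which reads [2 * alpha + 1 <= 3 * alpha], that is, [1 <= alpha]. *)
Lemma edge_cost_increase (f f' : nat) :
  1 <= alpha -> (f <= 1)%N -> (f' <= f.+1)%N ->
  alpha * (1 + (f%:R + 1)^-1) + 1 <= 2 * (alpha * (1 + (f'%:R + 1)^-1)).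
Proof.
move=> alpha1; rewrite !natr1.
by case: f f' => [|[|f]] [|[|[|f']]] // _ _; rewrite ?invr1; lra.
Qed.

Lemma cost_star_add_edge u v : 1 <= alpha -> u != c -> v != c -> u != v ->
  (cost alpha star tau u <= cost alpha (add_edge star u v) tau u)%E.
Proof.
move=> alpha1 uc vc uv; rewrite /cost deg_star_leaf // deg_star_add_edge // !mul1r.
apply: le_trans (leeD2l _ (total_dist_star_add_edge uc vc uv)) _.
rewrite [X in (_ + X)%E]addeC addeA -EFinD leeD2r // lee_fin.
have := friends_star_add_edge uc vc uv; rewrite friends_star_leaf //.
by apply: edge_cost_increase; rewrite // leq_b1.
Qed.

Lemma cost_star_del_edge u v : adj star u v ->
  cost alpha (del_edge star u v) tau u = +oo%E.
Proof.
rewrite adj_star => /andP[uv uvc]; rewrite /cost (@total_dist_pinfty _ _ _ _ v) ?addey //.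
(* The deletion isolates the leaf of the edge: this is [v] if [u] is the center, and [u] itself
   otherwise. *)
case/orP: uvc => /eqP e; subst.
  apply: dist_isolated_target => // w.
  rewrite adj_del_edge adj_star eqxx (eq_sym v) (negbTE uv) !andbT andbF !orbF.
  by case: eqP; rewrite ?andbF.
apply: dist_isolated_source => // w.
rewrite adj_del_edge adj_star eqxx (negbTE uv) /= orbF.
by case: eqP; rewrite ?andbF.
Qed.

Lemma star_pairwise_stable : 1 <= alpha -> pairwise_stable alpha star_network.
Proof.
move=> alpha1; split=> u v /=; first by move=> uv; rewrite cost_star_del_edge ?leey.
(* Distinct non-adjacent nodes of a star are both leaves. *)
rewrite adj_star eq_sym => uv; rewrite uv negb_or => /andP[uc vc].
by left; apply: cost_star_add_edge.
Qed.

End Stability.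

(** * Segregation of the star *)

Section Segregation.
Variable R : realType.

(** The center and the leaves together each account for [same_type_leaves] in the sum, which cancels
    the factor 2 of the denominator. *)
Lemma star_global_segregation :
  global_segregation R star_network = same_type_leaves%:R / (#|V|%:R - 1).
Proof.
have V0 : (0 < #|V|)%N by apply/card_gt0P; exists c.
rewrite /global_segregation /= -natr_sum (bigD1 c) //= sum_friends_star_leaves.
rewrite friends_star_center card_star -subn1 natrB // addnn -mul2n natrM.
by rewrite -mulf_div divff ?mul1r // pnatr_eq0.
Qed.

(** With [F] same-type leaves and [n] nodes, the center contributes [F / (n - 1)] and the leaves
    [F], in total [F * n / (n - 1)]. *)
Lemma star_local_segregation : (1 < #|V|)%N ->
  local_segregation R star_network = same_type_leaves%:R / (#|V|%:R - 1).
Proof.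
move=> V1; rewrite /local_segregation (bigD1 c) //= friends_star_center deg_star_center.
rewrite (eq_bigr (fun u => (friends star tau u)%:R)); last first.
  by move=> u uc; rewrite deg_star_leaf // divr1.
rewrite -natr_sum sum_friends_star_leaves -subn1 natrB 1?ltnW //.
have V1R : (1 : R) < #|V|%:R by rewrite ltr1n.
field; apply/andP; split; apply/eqP; lra.
Qed.

End Segregation.
End Star.

Theorem proposition4p6 (R : realType) (alpha : R) (k : nat) :
  1 <= alpha -> (2 <= k)%N ->
  forall n : nat, (2 <= n)%N ->
  (exists G : network 'I_n 'I_k,
     [/\ pairwise_stable alpha G, no_isolated G,
         global_segregation R G = 1 & local_segregation R G = 1]) /\
  (exists G' : network 'I_n 'I_k,
     [/\ pairwise_stable alpha G', no_isolated G',
         global_segregation R G' = 1 / (n%:R - 1) &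
         local_segregation R G' = 1 / (n%:R - 1)]).
Proof.
move=> alpha1; case: k => [|[|k]] // _; case=> [|[|n]] // _.
have card_gt1 : (1 < #|'I_n.+2|)%N by rewrite card_ord.
pose mono := fun _ : 'I_n.+2 => ord0 : 'I_k.+2.
(* The center is [ord0], and [ord_max] is the one leaf sharing its type. All other leaves get a
   second type, available since there are at least two; with two nodes there are no such leaves. *)
pose mixed (i : 'I_n.+2) : 'I_k.+2 :=
  if (i == ord0) || (i == ord_max) then ord0 else ord_max.
have mono_leaves : same_type_leaves ord0 mono = n.+1.
  rewrite -[n.+1]/(n.+2.-1) -[in RHS](card_ord n.+2) -(cardC1 (ord0 : 'I_n.+2)).
  by apply: eq_card => i; rewrite !inE eqxx andbT.
have mixed_leaves : same_type_leaves ord0 mixed = 1%N.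
  rewrite -(card1 (ord_max : 'I_n.+2)); apply: eq_card => i.
  by rewrite !inE /mixed eqxx /=; case: (eqVneq i ord_max) => [->|]; case: (eqVneq i ord0).
split; [exists (star_network ord0 mono)|exists (star_network ord0 mixed)]; split.
- exact: star_pairwise_stable.
- exact: no_isolated_star.
- by rewrite star_global_segregation mono_leaves card_ord -(@natrB _ n.+2 1) // subn1 divff ?pnatr_eq0.
- by rewrite star_local_segregation // mono_leaves card_ord -(@natrB _ n.+2 1) // subn1 divff ?pnatr_eq0.
- exact: star_pairwise_stable.
- exact: no_isolated_star.
- by rewrite star_global_segregation mixed_leaves card_ord.
- by rewrite star_local_segregation // mixed_leaves card_ord.
Qed.
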